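(* Let $k\ge 2$ and $0\le\epsilon\le k-1$ be integers. Let $A^{k,\epsilon}$ be the infinite lower-triangular integer matrix whose $(i,j)$ entry (for $i,j\ge 0$) is $\left|\mathcal{P}_{i+1,j+1}^{k,\epsilon}\right|$. Then $A^{k,\epsilon}$ is the proper Riordan array $\mathcal{R}\big(C_k(t)^{k-\epsilon},\, t\,C_k(t)^k\big)$; that is, for all $i,j\ge 0$, $$\left|\mathcal{P}_{i+1,j+1}^{k,\epsilon}\right| = [t^i]\, C_k(t)^{k-\epsilon}\big(t\,C_k(t)^k\big)^j.$$
   Context: Fix an integer $k\ge 2$. All lattice paths start at $(0,0)$ and use steps $E=(1,0)$ and $N=(0,1)$. For integers $n\ge 0$ and $0\le\epsilon\le (k-1)n$ and any integer $\delta$, let $\mathcal{P}_{n,\delta}^{k,\epsilon}$ denote the set of ordered pairs $(\gamma_1,\gamma_2)$ of such lattice paths satisfying: (1) $\gamma_2$ consists of exactly $(k-1)n$ steps, the first of which is an $E$ step; (2) $\gamma_1$ consists of exactly $(k-1)n-\epsilon$ steps, the first of which is an $N$ step whenever $\gamma_1$ has at least one step ($\gamma_1$ is the empty path when $\epsilon=(k-1)n$); (3) $\gamma_1$ and $\gamma_2$ have no common point other than $(0,0)$; (4) if $\gamma_1$ ends at $(x_1,y_1)$ and $\gamma_2$ ends at $(x_2,y_2)$, then $x_2-x_1=\delta$; (5) writing $\gamma_2=E N^{b_1} E N^{b_2}\cdots E N^{b_m}$ with $b_i\ge 0$, every $b_i$ satisfies $b_i\equiv k-2 \pmod{k-1}$.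 The $k$-Catalan (Fuss–Catalan) numbers are $C^k_n=\frac{1}{kn+1}\binom{kn+1}{n}$, with generating function $C_k(t)=\sum_{n\ge 0}C^k_n t^n$, which satisfies $C_k(t)=1+t\,C_k(t)^k$. For power series $d(t),h(t)$ with $d(0)\neq 0$, $h(0)=0$, $h'(0)\ne 0$, the proper Riordan array $\mathcal{R}(d(t),h(t))$ is the infinite lower-triangular matrix whose $(i,j)$ entry is $[t^i]\,d(t)h(t)^j$, where $[t^i]$ denotes the coefficient of $t^i$. *)

(* Defs.v *)
From HB Require Import structures.
From mathcomp Require Import all_boot all_order all_algebra.

Set Implicit Arguments.
Unset Strict Implicit.
Unset Printing Implicit Defensive.

Import Order.TTheory GRing.Theory Num.Theory.

Inductive step := E | N.

Definition bool_of_step (s : step) : bool := if s is E then true else false.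
Definition step_of_bool (b : bool) : step := if b then E else N.
Lemma bool_of_stepK : cancel bool_of_step step_of_bool.
Proof. by case. Qed.
HB.instance Definition _ := Finite.copy step (can_type bool_of_stepK).

(* A path is the sequence of its steps; every path starts at (0, 0). *)
Definition endpoint (g : seq step) : nat * nat := (count_mem E g, count_mem N g).

Definition points (g : seq step) : seq (nat * nat) :=
  [seq endpoint (take m g) | m <- iota 0 (size g).+1].

Definition meet_only_at_origin (g1 g2 : seq step) : bool :=
  all (fun p => (p \in points g2) ==> (p == (0, 0))) (points g1).

(* For g = E N^b_1 E N^b_2 ... E N^b_m, north_runs g = [:: b_1; ...; b_m]; see *)
(* north_runs_word and word_north_runs. The first component of the fold is the *)
(* number of N steps read (from the right) since the last E step.              *)
Definition north_runs (g : seq step) : seq nat :=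
  (foldr (fun s a => if s is E then (0, a.1 :: a.2) else (a.1.+1, a.2))
         (0, [::]) g).2.

Definition word_of_runs (b : seq nat) : seq step :=
  flatten [seq E :: nseq m N | m <- b].

Lemma north_runs_word (b : seq nat) : north_runs (word_of_runs b) = b.
Proof.
rewrite /north_runs.
suff -> : forall c : seq nat,
    foldr (fun s a => if s is E then (0, a.1 :: a.2) else (a.1.+1, a.2))
      (0, [::]) (word_of_runs c) = (0, c) by [].
elim=> [//|m c IHc]; rewrite /word_of_runs /= foldr_cat.
rewrite -/(word_of_runs c) IHc.
suff -> : foldr (fun s a => if s is E then (0, a.1 :: a.2) else (a.1.+1, a.2))
    (0, c) (nseq m N) = (m, c) by [].
by elim: m => //= m ->.
Qed.

Lemma word_north_runs (g : seq step) :
  ohead g = Some E -> word_of_runs (north_runs g) = g.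
Proof.
pose r := foldr (fun s a => if s is E then (0, a.1 :: a.2) else (a.1.+1, a.2))
            (0, [::] : seq nat).
have rK s : nseq (r s).1 N ++ word_of_runs (r s).2 = s.
  by elim: s => [//|[] s IHs]; rewrite /word_of_runs /= -[in RHS]IHs.
case: g => [//|[] // g _]; rewrite /north_runs -/(r g) /= -/(r g).
by rewrite -[in RHS](rK g).
Qed.

Definition path_pairs (k eps n : nat) (delta : int) :
    {set (k.-1 * n - eps).-tuple step * (k.-1 * n).-tuple step} :=
  [set g : (k.-1 * n - eps).-tuple step * (k.-1 * n).-tuple step |
   [&& ohead g.2 == Some E,
       nilp g.1 || (ohead g.1 == Some N),
       meet_only_at_origin g.1 g.2,
       ((endpoint g.2).1%:Z - (endpoint g.1).1%:Z)%R == delta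
     & all (fun b => b == k - 2 %[mod k.-1]) (north_runs g.2)]].

Definition path_pairs_matrix (k eps : nat) (i j : nat) : int :=
  #|path_pairs k eps i.+1 j.+1%:Z|%:Z.

Local Open Scope ring_scope.

Section PowerSeries.
Variable R : comNzRingType.

(* Formal power series over R, given by their coefficients: [t^n] f = f n. *)
Definition fps := nat -> R.

Definition fps1 : fps := fun n => (n == 0%N)%:R.
Definition fpsX : fps := fun n => (n == 1%N)%:R.
Definition fps_mul (f g : fps) : fps := fun n => \sum_(i < n.+1) f i * g (n - i)%N.
Definition fps_exp (f : fps) (m : nat) : fps := iter m (fps_mul f) fps1.

(* The value at 0 of the formal derivative of h is its coefficient h 1. *)
Definition proper_riordan_pair (d h : fps) : Prop :=
  [/\ d 0%N != 0, h 0%N = 0 & h 1%N != 0].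

Definition riordan_entry (d h : fps) (i j : nat) : R := fps_mul d (fps_exp h j) i.

Definition lower_triangular (A : nat -> nat -> R) : Prop :=
  forall i j : nat, (i < j)%N -> A i j = 0.

Definition is_proper_riordan_array (A : nat -> nat -> R) (d h : fps) : Prop :=
  [/\ proper_riordan_pair d h, lower_triangular A
    & forall i j : nat, A i j = riordan_entry d h i j].

End PowerSeries.

Definition fuss_catalan (k n : nat) : rat :=
  ((k * n + 1)%N%:R)^-1 * 'C(k * n + 1, n)%:R.

Definition fuss_catalan_series (k : nat) : fps rat := fuss_catalan k.

(* Main.v *)
(* Write K = k - 1. By condition (5), the second path is a word in the two blocks
   E N^(K-1) and N^K, and since both paths cross the antidiagonal x + y = m at
   time m, condition (3) says that D = x_2 - x_1 stays positive at equal times.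
   Removing the last step of the first path, or the last block of the second
   one when the first path is K steps shorter, shows that the number of pairs
   obeys the recurrence
     [t^n] C^(r+1) = [t^n] C^r + [t^(n-1)] C^(r+k),
   that is C^(r+1) = C^r + t C^(r+k), along which all the counts are read off:
   with K n - eps and K n steps there are [t^(n-D)] C^(k D - eps) pairs at
   final distance D. The same recurrence identifies the coefficients of C^r
   with r / (k n + r) * binomial (k n + r, n) and makes them multiplicative
   in r. *)
Require Import Defs.
From mathcomp Require Import all_boot all_order all_algebra.
From mathcomp Require Import zify ring.

Set Implicit Arguments.
Unset Strict Implicit.
Unset Printing Implicit Defensive.

Import Order.TTheory GRing.Theory Num.Theory.

(** * Coefficients of the powers of the Fuss-Catalan series *)

Section Raney.
Variable k : nat.

(* [raney n r] = [t^n] C_k(t)^r; see [fuss_catalan_series_exp]. *)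
Fixpoint raney (n : nat) : nat -> nat :=
  if n is n'.+1 then
    fix row r := if r is r'.+1 then row r' + raney n' (r' + k) else 0
  else fun=> 1.

Lemma raney0n r : raney 0 r = 1. Proof. by []. Qed.

Lemma raneyn0 n : raney n 0 = (n == 0). Proof. by case: n. Qed.

Lemma raneySS n r : raney n.+1 r.+1 = raney n.+1 r + raney n (r + k).
Proof. by []. Qed.

Lemma raney_bin n r : 0 < k ->
  (k * n + r) * raney n r = r * 'C(k * n + r, n).
Proof.
move=> k_gt0; elim: n r => [|n IHn] r.
  by rewrite raney0n bin0 muln0 add0n.
elim: r => [|r IHr]; first by rewrite raneyn0 /= muln0 mul0n.
rewrite raneySS addnS.
have := IHn (r + k); have -> : k * n + (r + k) = k * n.+1 + r by lia.
move: IHr; set M := k * n.+1 + r; set x := raney _ _; set y := raney _ _.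
move=> Hx Hy.
have M_gt0 : 0 < M by rewrite /M; nia.
have n_le_M : n <= M by rewrite /M; nia.
have e1 : n.+1 * 'C(M, n.+1) = (M - n) * 'C(M, n) by rewrite -mul_bin_left.
have e2 : n.+1 * 'C(M.+1, n.+1) = M.+1 * 'C(M, n) by rewrite -mul_bin_diag.
(* The factor [M] makes [Hx] and [Hy] applicable; [n.+1] reduces both binomials to ['C(M, n)]. *)
apply/eqP; rewrite -(eqn_pmul2l (m := n.+1 * M)) ?muln_gt0 ?M_gt0 //; apply/eqP.
have -> : n.+1 * M * (M.+1 * (x + y))
          = M.+1 * (n.+1 * (M * x) + n.+1 * (M * y)) by ring.
rewrite Hx Hy.
have -> : n.+1 * M * (r.+1 * 'C(M.+1, n.+1))
          = M * r.+1 * (n.+1 * 'C(M.+1, n.+1)) by ring.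
have -> : n.+1 * (r * 'C(M, n.+1)) = r * (n.+1 * 'C(M, n.+1)) by ring.
rewrite e1 e2.
have -> : M.+1 * (r * ((M - n) * 'C(M, n)) + n.+1 * ((r + k) * 'C(M, n)))
  = (r * (M - n) + n.+1 * (r + k)) * (M.+1 * 'C(M, n)) by ring.
(* What remains is r (M - n) + (n + 1)(r + k) = M (r + 1), true since M = k (n + 1) + r. *)
congr (_ * _); have [d defM] : exists d, M = n + d by exists (M - n); lia.
have -> : M - n = d by lia.
by rewrite mulnS {2}defM /M; ring.
Qed.

(** Passing from [p] to [p.+1] adds a convolution one degree lower with exponent [p + k]; the term i
    = 0 does not depend on [p]. *)
Lemma raney_conv n p q :
  \sum_(i < n.+1) raney i p * raney (n - i) q = raney n (p + q).
Proof.
elim: n p q => [|n IHn] p q; first by rewrite big_ord1.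
elim: p => [|p IHp].
  by rewrite big_ord_recl big1 ?addn0 ?mul1n.
rewrite addSn raneySS -IHp -addnA (addnC q) addnA -IHn.
rewrite big_ord_recl [in RHS]big_ord_recl -addnA; congr (_ + _).
rewrite -big_split /=; apply: eq_bigr => i _.
by rewrite /bump /= !add1n subSS -mulnDl.
Qed.

(* [raney_diag n D r] = [t^n] t^D C_k(t)^r. *)
Definition raney_diag n D r := if D <= n then raney (n - D) r else 0.

Lemma raney_diagS n D r :
  raney_diag n D r.+1 = raney_diag n D r + raney_diag n D.+1 (r + k).
Proof.
rewrite /raney_diag; case: ltngtP => [lt_Dn|//|->]; last by rewrite subnn.
by rewrite -(subSS D) subSn.
Qed.

Lemma raney_diagSS n D r : raney_diag n.+1 D.+1 r = raney_diag n D r.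
Proof. by rewrite /raney_diag ltnS subSS. Qed.

Lemma raney_diag_conv n D p q :
  \sum_(i < n.+1) raney i p * raney_diag (n - i) D q = raney_diag n D (p + q).
Proof.
elim: D n => [|D IHD] n.
  rewrite /raney_diag /= subn0 -raney_conv.
  by apply: eq_bigr => i _; rewrite subn0.
case: n => [|n]; first by rewrite big_ord1 muln0.
rewrite big_ord_recr /= subnn muln0 addn0 raney_diagSS -IHD.
by apply: eq_bigr => i _; rewrite subSn ?raney_diagSS // -ltnS.
Qed.

End Raney.

(** * Sums over words of a given length *)

Section Words.

(** Plain sequences, unlike tuples, can be split and extended without casts on lengths. *)
Fixpoint words n : seq (seq step) :=
  if n is n'.+1 then map (cons E) (words n') ++ map (cons N) (words n')
  else [:: [::]].

Lemma mem_words n w : (w \in words n) = (size w == n).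
Proof.
elim: n w => [|n IHn] [|s w] //=.
  by rewrite mem_cat; apply/negbTE; rewrite negb_or; apply/andP; split;
     apply/mapP => -[].
rewrite eqSS -IHn mem_cat; case: s.
  rewrite (mem_map (f := cons E)); last by move=> ? ? [].
  by rewrite [X in _ || X](_ : _ = false) ?orbF //; apply/mapP => -[].
rewrite orbC (mem_map (f := cons N)); last by move=> ? ? [].
by rewrite [X in _ || X](_ : _ = false) ?orbF //; apply/mapP => -[].
Qed.

Lemma words_uniq n : uniq (words n).
Proof.
elim: n => //= n IHn.
rewrite cat_uniq !map_inj_uniq ?IHn ?andbT /=; try by move=> ? ? [].
by apply/hasPn => w /mapP[u _ ->]; apply/mapP => -[].
Qed.

Lemma big_tuple_words n (F : seq step -> nat) :
  \sum_(t : n.-tuple step) F t = \sum_(w <- words n) F w.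
Proof.
transitivity (\sum_(w <- map val (enum {: n.-tuple step})) F w).
  by rewrite big_map big_enum.
apply: perm_big; apply: uniq_perm; last 1 first.
- move=> w; rewrite mem_words; apply/mapP/eqP => [[t _ ->]|sz_w].
    by rewrite size_tuple.
  by exists (Tuple (introT eqP sz_w)); rewrite ?mem_enum.
- by rewrite map_inj_uniq ?enum_uniq //; apply: val_inj.
- exact: words_uniq.
Qed.

Lemma big_words_cat a b (F : seq step -> nat) :
  \sum_(w <- words (a + b)) F w =
  \sum_(u <- words a) \sum_(v <- words b) F (u ++ v).
Proof.
elim: a F => [|a IHa] F /=; first by rewrite big_seq1.
by rewrite !big_cat !big_map /= !IHa.
Qed.

Lemma big_words_rcons n (F : seq step -> nat) :
  \sum_(w <- words n.+1) F w =
  \sum_(w <- words n) (F (rcons w E) + F (rcons w N)).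
Proof.
rewrite -addn1 big_words_cat; apply: eq_bigr => u _.
by rewrite /= !big_cons big_nil addn0 !cats1.
Qed.

End Words.

(** * The block structure of the second path *)

Section PathPairs.
Variable K : nat.
Hypothesis K_gt0 : 0 < K.

(* The residue condition on the north runs, read on suffixes: reading from the *)
(* right, each run closes a suffix whose length is a multiple of K.            *)
Fixpoint east_aligned (g : seq step) : bool :=
  if g is s :: g' then ((s == E) ==> (K %| (size g').+1)) && east_aligned g'
  else true.

Lemma north_runs_aligned (g : seq step) :
  all (fun b => b == K.-1 %[mod K]) (north_runs g) = east_aligned g.
Proof.
rewrite /north_runs.
set r := foldr _ _.
(* The closed runs with their E steps fill a multiple of [K] steps, so the run still open has the
   residue of the whole suffix. *)
suff [//] : all (fun b => b == K.-1 %[mod K]) (r g).2 = east_aligned g /\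
  (east_aligned g -> (r g).1 = size g %[mod K]).
elim: g => [//|s g [IH1 IH2]] /=; rewrite -/(r g); split; case: s => //=.
- rewrite IH1; case Hg: (east_aligned g); rewrite ?andbF ?andbT //.
  by rewrite (IH2 Hg) /dvdn -(eqn_modDr 1) !addn1 prednK // modnn.
- by move=> /andP[/dvdnP[q ->] _]; rewrite modnMl mod0n.
- by move=> /IH2 e; rewrite -addn1 -modnDml e modnDml addn1.
Qed.

Lemma east_aligned_cat (g h : seq step) : K %| size h ->
  east_aligned (g ++ h) = east_aligned g && east_aligned h.
Proof.
move=> Kh; elim: g => //= s g ->.
by rewrite size_cat -addSn dvdn_addl // andbA.
Qed.

Lemma east_aligned_small (g : seq step) : size g < K ->
  east_aligned g = (count_mem E g == 0).
Proof.
elim: g => //= s g IHg lt_gK; rewrite IHg 1?ltnW //.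
case: s => //=; rewrite add1n; case: (boolP (_ %| _)) => //.
by move/dvdn_leq => /(_ isT); rewrite leqNgt lt_gK.
Qed.

Lemma count_E_eq0 (g : seq step) :
  (count_mem E g == 0) = (g == nseq (size g) N).
Proof. by elim: g => [|[] g IHg] //=; rewrite add0n IHg eqseq_cons eqxx. Qed.

Lemma big_north_words n (F : seq step -> nat) :
  \sum_(w <- words n | count_mem E w == 0) F w = F (nseq n N).
Proof.
rewrite big_seq_cond (eq_bigl (fun w => w == nseq n N)); last first.
  move=> w; rewrite mem_words count_E_eq0; case: (size w =P n) => [->//|ne].
  by apply/esym/negbTE/eqP => e; case: ne; rewrite e size_nseq.
rewrite -big_filter (_ : filter _ _ = [:: nseq n N]) ?big_seq1 //.
by apply: filter_pred1_uniq; rewrite ?words_uniq ?mem_words ?size_nseq.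
Qed.

(** Within [K] steps, only the first can be an aligned E. *)
Lemma big_block_words (F : seq step -> nat) :
  \sum_(w <- words K | east_aligned w) F w =
  F (E :: nseq K.-1 N) + F (nseq K N).
Proof.
have tailE s : \sum_(w <- words K.-1 | east_aligned (s :: w)) F (s :: w)
               = F (s :: nseq K.-1 N).
  rewrite -(big_north_words _ (fun w => F (s :: w))).
  rewrite big_seq_cond [in RHS]big_seq_cond; apply: eq_bigl => w.
  rewrite mem_words; case: eqP => //= sz_w.
  rewrite east_aligned_small ?sz_w ?prednK // dvdnn implybT; exact: andTb.
rewrite -[in words K](prednK K_gt0) /= big_cat !big_map !tailE.
by rewrite -[K in F (nseq K N)](prednK K_gt0).
Qed.

Lemma east_aligned_suffix (g h : seq step) :
  east_aligned (g ++ h) -> east_aligned h.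
Proof. by elim: g => //= s g IHg /andP[_ /IHg]. Qed.

(** Fewer than [K] steps remain after time [m], too few for an aligned E. *)
Lemma count_E_take_aligned n m (g : seq step) :
  east_aligned g -> size g = K * n.+1 -> K * n < m ->
  count_mem E (take m g) = count_mem E g.
Proof.
move=> al_g sz_g lt_m; rewrite -[in RHS](cat_take_drop m g) count_cat.
have al_d : east_aligned (drop m g).
  by apply: (@east_aligned_suffix (take m g)); rewrite cat_take_drop.
have sz_d : size (drop m g) < K by rewrite size_drop sz_g; nia.
by move: al_d; rewrite east_aligned_small // => /eqP ->; rewrite addn0.
Qed.

Lemma count_EN (g : seq step) : count_mem E g + count_mem N g = size g.
Proof.
by elim: g => //= s g <-; case: s; rewrite !add0n ?add1n ?addSn ?addnS.
Qed.

Lemma count_E_takeS m (g : seq step) :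
  count_mem E (take m g) <= count_mem E (take m.+1 g)
                         <= (count_mem E (take m g)).+1.
Proof.
elim: g m => [|s g IHg] [|m] //=; first by rewrite take0; case: s.
by rewrite -addnS !leq_add2l.
Qed.

(** * Disjointness as a positive gap at equal times *)

Definition separated (g1 g2 : seq step) : bool :=
  all (fun m => count_mem E (take m g1) < count_mem E (take m g2))
      (iota 1 (size g1)).

(* Both paths meet the antidiagonal x + y = m exactly at time m, so a common   *)
(* point can only be reached by both at the same time.                         *)
Lemma meet_only_at_originE (g1 g2 : seq step) : size g1 <= size g2 ->
  meet_only_at_origin g1 g2 =
  all (fun m => count_mem E (take m g1) != count_mem E (take m g2))
      (iota 1 (size g1)).
Proof.
move=> le12; apply/allP/allP => [meet m | sep p /mapP[m]].
  rewrite mem_iota => /andP[m_gt0 lt_m]; apply/eqP => eqE.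
  have le_m : m <= size g1 by lia.
  have sz1 := size_takel le_m; have sz2 := size_takel (leq_trans le_m le12).
  have e12 : endpoint (take m g1) = endpoint (take m g2).
    have := count_EN (take m g1); have := count_EN (take m g2).
    by rewrite /endpoint eqE sz1 sz2 => h2 h1; congr pair; lia.
  have in1 : endpoint (take m g1) \in points g1.
    by apply: (map_f (fun i => endpoint (take i g1))); rewrite mem_iota; lia.
  have in2 : endpoint (take m g1) \in points g2.
    rewrite e12; apply: (map_f (fun i => endpoint (take i g2))).
    by rewrite mem_iota; lia.
  have := meet _ in1; rewrite in2 => /eqP [c1 c2].
  by have := count_EN (take m g1); rewrite c1 c2 sz1 => m0; rewrite -m0 in m_gt0.
rewrite mem_iota => lt_m ->; apply/implyP => /mapP[m'].
rewrite mem_iota => lt_m' [eqE eqN].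
have le_m : m <= size g1 by lia.
have le_m' : m' <= size g2 by lia.
have := count_EN (take m g1); have := count_EN (take m' g2).
rewrite !size_takel // => h2 h1; have eqm : m' = m by rewrite -h1 -h2 eqE eqN.
case: m lt_m eqE {eqN le_m h1} eqm => [|m] lt_m eqE eqm; first by rewrite take0.
have := sep m.+1; rewrite mem_iota => /(_ ltac:(lia)).
by rewrite eqE eqm eqxx.
Qed.

(** The gap is 1 after the steps N and E and changes by at most 1 per step, so it cannot turn
    negative without vanishing. Conversely, a positive gap at time 1 forces the first path to start
    with N. *)
Lemma separatedE (g1 g2 : seq step) : size g1 <= size g2 -> ohead g2 = Some E ->
  (nilp g1 || (ohead g1 == Some N)) && meet_only_at_origin g1 g2
  = separated g1 g2.
Proof.
move=> le12 hd2; rewrite meet_only_at_originE //.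
apply/andP/allP => [[hd1 /allP ne] m | sep].
  elim: m => [|m IHm]; rewrite mem_iota // => lt_m.
  case: m IHm lt_m => [_ lt_m|m IHm lt_m].
    case: g1 hd1 lt_m {le12 ne} => [|[] g1] //= _ _.
    by case: g2 hd2 => [|[] g2] //= _; rewrite !take0.
  have := ne m.+2; rewrite mem_iota => /(_ lt_m).
  have := IHm; rewrite mem_iota => /(_ ltac:(lia)).
  by have := count_E_takeS m.+1 g1; have := count_E_takeS m.+1 g2; lia.
split; last by apply/allP => m /sep; lia.
case: g1 le12 sep => [|[] g1] // le12 /(_ 1); rewrite mem_iota => /(_ isT).
by case: g2 hd2 le12 => [|[] g2] //=; rewrite !take0.
Qed.

Lemma separated_rcons (g1 : seq step) s (g2 : seq step) :
  separated (rcons g1 s) g2 = separated g1 g2 &&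
    (count_mem E (rcons g1 s) < count_mem E (take (size g1).+1 g2)).
Proof.
rewrite /separated size_rcons -{1}(addn1 (size g1)) iotaD all_cat /= andbT add1n.
rewrite (take_oversize (s := rcons _ _)) ?size_rcons //; congr (_ && _).
apply: eq_in_all => m; rewrite mem_iota => lt_m.
by rewrite -cats1 takel_cat //; lia.
Qed.

Lemma separated_catr (g1 g2 h : seq step) : size g1 <= size g2 ->
  separated g1 (g2 ++ h) = separated g1 g2.
Proof.
move=> le12; apply: eq_in_all => m; rewrite mem_iota => lt_m.
by rewrite takel_cat //; lia.
Qed.

(** * Recurrences for the number of pairs *)

Definition admissible (D : nat) (g1 g2 : seq step) : bool :=
  [&& ohead g2 == Some E, east_aligned g2, separated g1 g2
    & count_mem E g2 == count_mem E g1 + D].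

(** Independent lengths allow one path to be shortened while the other is kept. *)
Definition nb_pairs l1 l2 D : nat :=
  \sum_(g1 <- words l1) \sum_(g2 <- words l2) admissible D g1 g2.

Lemma count_rcons (s0 s : step) (g : seq step) :
  count_mem s0 (rcons g s) = count_mem s0 g + (s == s0).
Proof. by rewrite -cats1 count_cat /= addn0. Qed.

(** By time [l.+1] the second path has made all its E steps, so the new separation condition follows
    from the positive final gap. Removing an E from the first path widens that gap by 1. *)
Lemma nb_pairs_last_step n l D : K * n <= l ->
  nb_pairs l.+1 (K * n.+1) D.+1 =
  nb_pairs l (K * n.+1) D.+1 + nb_pairs l (K * n.+1) D.+2.
Proof.
move=> le_l; rewrite /nb_pairs big_words_rcons -big_split /=.
apply: eq_big_seq => g1; rewrite mem_words => /eqP sz1.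
rewrite addnC -!big_split /=.
apply: eq_big_seq => g2; rewrite mem_words => /eqP sz2.
have last_step s : admissible D.+1 (rcons g1 s) g2
                   = admissible (D.+1 + (s == E)) g1 g2.
  rewrite /admissible; congr (_ && _); apply: andb_id2l => al2.
  rewrite separated_rcons (@count_E_take_aligned n) ?sz1 // count_rcons.
  by case: separated => //=; lia.
by rewrite !last_step addn0 addn1.
Qed.

(** The last block lies beyond the end of the first path, so it affects only the final gap; [0 < n]
    keeps the initial E out of it. *)
Lemma nb_pairs_last_block n D : 0 < n ->
  nb_pairs (K * n) (K * n.+1) D.+1 =
  nb_pairs (K * n) (K * n) D + nb_pairs (K * n) (K * n) D.+1.
Proof.
move=> n_gt0; rewrite /nb_pairs -big_split /=.
apply: eq_big_seq => g1; rewrite mem_words => /eqP sz1.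
rewrite mulnSr big_words_cat -big_split /=.
apply: eq_big_seq => g2; rewrite mem_words => /eqP sz2.
have catE h : size h = K -> admissible D.+1 g1 (g2 ++ h) = east_aligned h &&
    [&& ohead g2 == Some E, east_aligned g2, separated g1 g2
    & count_mem E g2 + count_mem E h == count_mem E g1 + D.+1].
  move=> szh; rewrite /admissible east_aligned_cat ?szh //.
  rewrite separated_catr ?sz1 ?sz2 //.
  rewrite count_cat; case: g2 sz2 => [|s g2] /= sz2; first by nia.
  by rewrite -!andbA; do !bool_congr.
transitivity (\sum_(h <- words K | east_aligned h)
    [&& ohead g2 == Some E, east_aligned g2, separated g1 g2
    & count_mem E g2 + count_mem E h == count_mem E g1 + D.+1] : nat).
  rewrite [RHS]big_mkcond; apply: eq_big_seq => h.
  by rewrite mem_words => /eqP /catE ->; case: east_aligned.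
rewrite big_block_words /= !count_nseq /= !mul0n addn0 addn1 addnS eqSS.
by rewrite addn0 -addnS.
Qed.

Lemma nb_pairs_first_block D : nb_pairs 0 K D = (D == 1).
Proof.
rewrite /nb_pairs /= big_seq1.
transitivity (\sum_(h <- words K | east_aligned h)
    ((ohead h == Some E) && (count_mem E h == D)) : nat).
  rewrite [RHS]big_mkcond; apply: eq_bigr => h _; rewrite /admissible /=.
  by case: east_aligned; rewrite ?andbF.
rewrite big_block_words /= !count_nseq /= -[in nseq K _](prednK K_gt0) /=.
by rewrite addn0 eq_sym.
Qed.

Lemma nb_pairs_meeting l : 0 < l -> nb_pairs l l 0 = 0.
Proof.
move=> l_gt0; rewrite /nb_pairs big1_seq // => g1.
rewrite mem_words /= => /eqP sz1.
rewrite big1_seq // => g2; rewrite mem_words /= => /eqP sz2.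
apply/eqP; rewrite eqb0; apply/negP => /and4P[_ _ /allP /(_ l)].
rewrite mem_iota sz1 => /(_ ltac:(lia)).
by rewrite !take_oversize ?sz1 ?sz2 //; lia.
Qed.

(** Each extra step of the first path raises the exponent by 1, as in [raney_diagS]. The case d = K
    for [n] has equal lengths, and adding a block gives d = 0 for [n.+1]. *)
Lemma nb_pairs_raney n d D : d <= K ->
  nb_pairs (K * n + d) (K * n.+1) D.+1 =
  raney_diag K.+1 n D (K.+1 * D + d.+1).
Proof.
elim: n d D => [|n IHn] d D; elim: d D => [|d IHd] D le_d.
- rewrite muln0 muln1 nb_pairs_first_block eqSS /raney_diag leqn0.
  by case: D.
- rewrite addnS nb_pairs_last_step ?leq_addr // !IHd 1?ltnW //.
  rewrite [in RHS]addnS raney_diagS; congr (_ + raney_diag _ _ _ _); lia.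
- rewrite addn0 nb_pairs_last_block //.
  have IHK D' := IHn K D' (leqnn K).
  rewrite -mulnSr in IHK.
  rewrite IHK [in RHS]addnS raney_diagS addn0; congr (_ + _).
  (* For D = 0 both sides vanish: the paths would meet, and C^0 has no term of positive degree. *)
  case: D => [|D]; last by rewrite IHK raney_diagSS; congr raney_diag; lia.
  by rewrite nb_pairs_meeting ?muln_gt0 ?K_gt0 // muln0.
- rewrite addnS nb_pairs_last_step ?leq_addr // !IHd 1?ltnW //.
  rewrite [in RHS]addnS raney_diagS; congr (_ + raney_diag _ _ _ _); lia.
Qed.

Lemma card_path_pairs eps n D :
  #|path_pairs K.+1 eps n D%:Z| = nb_pairs (K * n - eps) (K * n) D.
Proof.
rewrite /nb_pairs.
rewrite -(big_tuple_words _ (fun g1 => \sum_(g2 <- words _) admissible D g1 g2)).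
under eq_bigr => g1 _ do rewrite -(big_tuple_words _ (admissible D g1)).
rewrite pair_bigA -sum1_card big_mkcond /=; apply: eq_bigr => -[g1 g2] _.
rewrite inE /= /admissible /=.
rewrite subn2 /= north_runs_aligned.
have [hd2|//] := eqVneq (ohead g2) (Some E).
rewrite -(@separatedE g1 g2) ?size_tuple ?leq_subr //.
have -> : ((count_mem E g2)%:Z - (count_mem E g1)%:Z == D%:Z)%R
          = (count_mem E g2 == count_mem E g1 + D) by lia.
rewrite andTb -andbA [east_aligned g2 && _]andbC -!andbA.
by case: ([&& _, _, _ & _]).
Qed.

End PathPairs.

(** * Power series and the Riordan array *)

Local Open Scope ring_scope.

Lemma fuss_catalanE k n : (0 < k)%N -> fuss_catalan k n = (raney k n 1)%:R.
Proof.
move=> k_gt0; rewrite /fuss_catalan; have := raney_bin n 1 k_gt0.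
rewrite mul1n => <-; rewrite natrM mulKf // pnatr_eq0.
by rewrite addn1.
Qed.

Section FussCatalanPowers.
Variable k : nat.
Hypothesis k_gt0 : (0 < k)%N.

Lemma fuss_catalan_series_exp r n :
  fps_exp (fuss_catalan_series k) r n = (raney k n r)%:R.
Proof.
elim: r n => [|r IHr] n; first by rewrite raneyn0.
rewrite -add1n -raney_conv natr_sum; apply: eq_bigr => i _.
by rewrite natrM -IHr -fuss_catalanE.
Qed.

Lemma fpsX_mul (f : fps rat) n :
  fps_mul (@fpsX rat) f n = if n is n'.+1 then f n' else 0.
Proof.
rewrite /fps_mul /fpsX; case: n => [|n]; first by rewrite big_ord1 mul0r.
rewrite big_ord_recl mul0r add0r big_ord_recl /= mul1r subn1 big1 ?addr0 //.
by move=> i _; rewrite mul0r.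
Qed.

(** Each factor t C^k shifts the degree by 1 and adds [k] to the exponent. *)
Lemma fuss_catalan_column_exp j n :
  fps_exp (fps_mul (@fpsX rat) (fps_exp (fuss_catalan_series k) k)) j n
  = (raney_diag k n j (k * j))%:R.
Proof.
elim: j n => [|j IHj] n; first by rewrite muln0 /raney_diag subn0 raneyn0.
rewrite [LHS]/fps_mul; case: n => [|n]; first by rewrite big_ord1 fpsX_mul mul0r.
rewrite big_ord_recl fpsX_mul mul0r add0r raney_diagSS mulnS -raney_diag_conv.
rewrite natr_sum; apply: eq_bigr => i _.
by rewrite fpsX_mul natrM -fuss_catalan_series_exp -IHj.
Qed.

End FussCatalanPowers.

Theorem theorem2p2 (k eps : nat) (hk : (2 <= k)%N) (heps : (eps <= k - 1)%N) :
  is_proper_riordan_array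
    (fun i j : nat => (path_pairs_matrix k eps i j)%:~R : rat)
    (fps_exp (fuss_catalan_series k) (k - eps))
    (fps_mul (@fpsX rat) (fps_exp (fuss_catalan_series k) k)).
Proof.
have k_gt0 : (0 < k)%N by lia.
have entryE i j : (path_pairs_matrix k eps i j)%:~R
                  = (raney_diag k i j (k * j + (k - eps)))%:R :> rat.
  case: k hk heps {k_gt0} => [//|K] K_gt0 le_eps.
  rewrite /path_pairs_matrix card_path_pairs //.
  (* Here d = K - eps, so the exponent K.+1 j + d + 1 equals k j + (k - eps). *)
  have -> : (K * i.+1 - eps = K * i + (K - eps))%N by lia.
  rewrite nb_pairs_raney ?leq_subr //.
  by rewrite -subSn //; lia.
split.
- by split; rewrite ?fpsX_mul ?fuss_catalan_series_exp.
- by move=> i j lt_ij; rewrite entryE /raney_diag leqNgt lt_ij.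
move=> i j; rewrite entryE addnC -raney_diag_conv natr_sum.
apply: eq_bigr => l _.
by rewrite fuss_catalan_series_exp // fuss_catalan_column_exp // natrM.
Qed.
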